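(* Let $n$ be a positive integer with $n\equiv 3\pmod 6$, and let $H$ be a finite abelian group of order $n^2+n+1$ with identity $e$. Then there are no inverse-closed subsets $T_0,T_1\subseteq H$ with $e\in T_0$ and $|T_0|+|T_1|=2n+1$ satisfying in $\mathbb{Z}[H]$ $$T_0T_1=H-e\quad\text{and}\quad T_0^2+T_1^2=2H-T_0^{(2)}-T_1^{(2)}+2n\,e.$$
   Context: $\mathbb{Z}[H]$ is the group ring of $H$ over $\mathbb{Z}$; a subset $D\subseteq H$ is identified with $\sum_{d\in D}d$, and $H$ also denotes $\sum_{h\in H}h$. For $A=\sum a_h h$ and $t\in\mathbb{Z}$, $A^{(t)}=\sum a_h h^t$. A subset $D$ is inverse-closed if $D^{(-1)}=D$. *)

(* Defs.v *)
From HB Require Import structures.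
From mathcomp Require Import all_boot all_order all_fingroup all_algebra.

Set Implicit Arguments.
Unset Strict Implicit.
Unset Printing Implicit Defensive.

Import GRing.Theory.
Local Open Scope ring_scope.

(* The integral group ring Z[gT]: coefficient functions gT -> int. The alias   *)
(* keeps the convolution product apart from the canonical pointwise product on *)
(* {ffun gT -> int}; multinomials' {malg int[_]} does not apply because its    *)
(* monoids have no nontrivial units.                                           *)
Definition group_ringZ (gT : finGroupType) : Type := {ffun gT -> int}.

HB.instance Definition _ (gT : finGroupType) :=
  GRing.Zmodule.copy (group_ringZ gT) {ffun gT -> int}.

Section GroupRing.
Variable gT : finGroupType.
Implicit Types (A B C : group_ringZ gT) (D : {set gT}) (g h x y z : gT).

Definition gcoef A x : int := (A : {ffun gT -> int}) x.

Lemma gcoefP A B : gcoef A =1 gcoef B <-> A = B.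
Proof. by split=> [AB|-> //]; apply/ffunP. Qed.

Lemma gcoefD A B x : gcoef (A + B) x = gcoef A x + gcoef B x.
Proof. by rewrite /gcoef ffunE. Qed.

Lemma gcoef0 x : gcoef 0 x = 0.
Proof. by rewrite /gcoef ffunE. Qed.

Lemma gcoefN A x : gcoef (- A) x = - gcoef A x.
Proof. by rewrite /gcoef ffunE. Qed.

Lemma gcoefMn A n x : gcoef (A *+ n) x = gcoef A x *+ n.
Proof. by elim: n => [|n IHn]; rewrite ?gcoef0 // !mulrS gcoefD IHn. Qed.

Lemma gcoefMz A (m : int) x : gcoef (A *~ m) x = gcoef A x *~ m.
Proof.
by case: m => n; rewrite ?NegzE ?mulrNz ?gcoefN -!pmulrn gcoefMn.
Qed.

Lemma gcoef_sum (I : Type) (r : seq I) (P : pred I) (F : I -> group_ringZ gT) x :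
  gcoef (\sum_(i <- r | P i) F i) x = \sum_(i <- r | P i) gcoef (F i) x.
Proof. exact: (big_morph (gcoef^~ x) (fun A B => gcoefD A B x) (gcoef0 x)). Qed.

Definition gelem g : group_ringZ gT := [ffun x => (x == g)%:R].

Definition gmul A B : group_ringZ gT :=
  [ffun x => \sum_y gcoef A y * gcoef B (y^-1 * x)%g].

Lemma gcoef_elem g x : gcoef (gelem g) x = (x == g)%:R.
Proof. by rewrite /gcoef ffunE. Qed.

Lemma gcoef_gmul A B x :
  gcoef (gmul A B) x = \sum_y gcoef A y * gcoef B (y^-1 * x)%g.
Proof. by rewrite /gcoef ffunE. Qed.

Lemma gmulA : associative gmul.
Proof.
move=> A B C; apply/gcoefP => x; rewrite !gcoef_gmul.
under eq_bigr => y _ do rewrite gcoef_gmul big_distrr /=.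
under [RHS]eq_bigr => z _ do rewrite gcoef_gmul big_distrl /=.
rewrite [RHS]exchange_big /=; apply: eq_bigr => y _.
rewrite [RHS](reindex_inj (mulgI y)) /=; apply: eq_bigr => z _.
by rewrite mulKg invMg mulrA mulgA.
Qed.

Lemma gmul1l : left_id (gelem 1) gmul.
Proof.
move=> A; apply/gcoefP => x; rewrite gcoef_gmul (bigD1 1%g) //= big1.
  by rewrite gcoef_elem eqxx mul1r invg1 mul1g addr0.
by move=> y /negPf y1; rewrite gcoef_elem y1 mul0r.
Qed.

Lemma gmul1r : right_id (gelem 1) gmul.
Proof.
move=> A; apply/gcoefP => x; rewrite gcoef_gmul (bigD1 x) //= big1.
  by rewrite gcoef_elem mulVg eqxx mulr1 addr0.
by move=> y yx; rewrite gcoef_elem -eq_mulVg1 (negPf yx) mulr0.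
Qed.

Lemma gmulDl : left_distributive gmul +%R.
Proof.
move=> A B C; apply/gcoefP => x; rewrite gcoefD !gcoef_gmul -big_split /=.
by apply: eq_bigr => y _; rewrite gcoefD mulrDl.
Qed.

Lemma gmulDr : right_distributive gmul +%R.
Proof.
move=> A B C; apply/gcoefP => x; rewrite gcoefD !gcoef_gmul -big_split /=.
by apply: eq_bigr => y _; rewrite gcoefD mulrDr.
Qed.

Lemma gelem1_neq0 : gelem 1 != 0.
Proof.
apply/eqP => /gcoefP/(_ 1%g); rewrite gcoef_elem eqxx.
by rewrite gcoef0.
Qed.

HB.instance Definition _ :=
  GRing.Zmodule_isNzRing.Build (group_ringZ gT)
    gmulA gmul1l gmul1r gmulDl gmulDr gelem1_neq0.

Lemma gcoefM A B x :
  gcoef (A * B) x = \sum_y gcoef A y * gcoef B (y^-1 * x)%g.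
Proof. exact: gcoef_gmul. Qed.

Lemma gelem1 : gelem 1 = 1.
Proof. by []. Qed.

Lemma gelemM g h : gelem (g * h) = gelem g * gelem h.
Proof.
apply/gcoefP => x; rewrite gcoefM (bigD1 g) //= big1 => [|y /negPf yg].
  by rewrite !gcoef_elem eqxx mul1r addr0 (can2_eq (mulKVg _) (mulKg _)).
by rewrite gcoef_elem yg mul0r.
Qed.

Definition gsum D : group_ringZ gT := \sum_(d in D) gelem d.

Lemma gcoef_gsum D x : gcoef (gsum D) x = (x \in D)%:R.
Proof.
rewrite gcoef_sum.
under eq_bigr => d _ do rewrite gcoef_elem.
have [xD|xND] := boolP (x \in D).
  rewrite (bigD1 x) //= eqxx big1 ?addr0 // => d /andP[_ /negPf].
  by rewrite eq_sym => ->.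
rewrite big1 // => d dD; rewrite (_ : (x == d) = false) //.
by apply: contraNF xND => /eqP->.
Qed.

Definition expgz h (t : int) : gT :=
  match t with Posz k => (h ^+ k)%g | Negz k => (h ^- k.+1)%g end.

(* A^(t): the exponent acts on the group elements, not on A as a ring element. *)
Definition gring_pow (t : int) A : group_ringZ gT :=
  \sum_h gelem (expgz h t) *~ gcoef A h.

Lemma gcoef_gring_pow t A x :
  gcoef (gring_pow t A) x = \sum_(h | expgz h t == x) gcoef A h.
Proof.
rewrite gcoef_sum [RHS]big_mkcond /=; apply: eq_bigr => h _.
by rewrite gcoefMz gcoef_elem eq_sym; case: eqP; rewrite ?mul0rz ?intz.
Qed.

Definition inverse_closed D : Prop := gring_pow (-1) (gsum D) = gsum D.

Lemma inverse_closedP D : inverse_closed D <-> (D^-1)%g = D.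
Proof.
have E x : gcoef (gring_pow (-1) (gsum D)) x = ((x^-1)%g \in D)%:R.
  rewrite gcoef_gring_pow (bigD1 (x^-1)%g) /= ?expg1 ?invgK //.
  rewrite gcoef_gsum big1 ?addr0 // => h /andP[/eqP <-].
  by rewrite expg1 invgK eqxx.
split=> [/gcoefP DV|DV].
  apply/setP => x; have := DV x; rewrite E gcoef_gsum mem_invg.
  by case: (_ \in D); case: (x \in D).
by apply/gcoefP => x; rewrite E gcoef_gsum -mem_invg DV.
Qed.

End GroupRing.

(* Main.v *)
Require Import Defs.
From mathcomp Require Import all_boot all_order all_fingroup all_algebra all_solvable.
From mathcomp Require Import zify ring.

(* Write p = T0^(2) + T1^(2), so that |T0| = n and |T1| = n + 1, and let c be the
   coefficient function of T0 p. Multiplying the quadratic equation by T0 and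
   using T0^3 = T0^(3) mod 3, one gets c = lam mod 3 with
   lam = 2 - 2 T1 - T0^(3), hence c >= lam pointwise, and the excess c - lam has
   total weight 2n. Since T1 T0 p = (2n+1) H - p, the sum of c over T1 is 2n, so
   the whole excess lies on T1 and c <= 2 elsewhere. Multiplying once more by T1
   gives c <= 6 everywhere. The second moment of c is the coefficient of e in
   T0^2 p^2, which is at least 6n^2 - 7n, whereas these bounds make it at most
   4n^2 + 10n; hence n <= 8, i.e. n = 3. Then H is cyclic of order 13, T0 is
   {e, a, a^-1}, and T0 T1 = H - e forces a^2, a^5, a^8, a^11 into T1, so that
   a^3 has three representations in T1^2, against the quadratic equation. *)

Set Implicit Arguments.
Unset Strict Implicit.
Unset Printing Implicit Defensive.

Import Order.TTheory GRing.Theory Num.Theory.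
Local Open Scope ring_scope.

(** The inner binomial coefficients are divisible by [p]. The congruence modulo [p] carries an
    explicit witness [z] because the ring has no prescribed characteristic. *)
Lemma exprD_prime_comm (R : nzRingType) (p : nat) (x y : R) :
  prime p -> GRing.comm x y ->
  exists z, (x + y) ^+ p = x ^+ p + y ^+ p + z *+ p.
Proof.
case: p => // p p_pr cxy; rewrite exprDn_comm // big_ord_recl big_ord_recr /=.
rewrite subn0 expr0 mulr1 bin0 mulr1n /bump /= !add1n subnn expr0 mul1r binn.
exists (\sum_(i < p) (x ^+ (p.+1 - i.+1) * y ^+ i.+1) *+ ('C(p.+1, i.+1) %/ p.+1)).
rewrite !mulr1n -sumrMnl [X in _ + X]addrC addrA; congr (_ + _).
apply: eq_bigr => i _; rewrite -mulrnA divnK // ?add1n //.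
by apply: prime_dvd_bin => //; rewrite /= ltnS ltn_ord.
Qed.

(** * Augmentation and coefficients in the group ring *)

Section GroupRingTheory.

Variable gT : finGroupType.
Implicit Types (A B C : group_ringZ gT) (D E : {set gT}) (x y : gT).

Definition aug A : int := \sum_x gcoef A x.

Lemma augM A B : aug (A * B) = aug A * aug B.
Proof.
rewrite /aug big_distrl /=; under eq_bigr => x _ do rewrite gcoefM.
rewrite exchange_big /=; apply: eq_bigr => y _.
by rewrite -big_distrr (reindex_inj (mulgI y)) /=; under eq_bigr do rewrite mulKg.
Qed.

Lemma augD A B : aug (A + B) = aug A + aug B.
Proof. by rewrite -big_split; apply: eq_bigr => x _; rewrite gcoefD. Qed.

Lemma aug_gsum D : aug (gsum D) = #|D|%:Z.
Proof.
rewrite /aug; under eq_bigr => x _ do rewrite gcoef_gsum.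
by rewrite -natr_sum -big_mkcond /= sum1_card natz.
Qed.

Lemma gcoef_gsumT x : gcoef (gsum [set: gT]) x = 1.
Proof. by rewrite gcoef_gsum inE. Qed.

Lemma gcoef_gsum_ge0 D x : 0 <= gcoef (gsum D) x.
Proof. by rewrite gcoef_gsum ler0n. Qed.

Lemma gcoefM_ge0 A B : (forall x, 0 <= gcoef A x) -> (forall x, 0 <= gcoef B x) ->
  forall x, 0 <= gcoef (A * B) x.
Proof. by move=> A0 B0 x; rewrite gcoefM sumr_ge0 // => y _; rewrite mulr_ge0. Qed.

Lemma gcoef_mulT A x : gcoef (A * gsum [set: gT]) x = aug A.
Proof. by rewrite gcoefM; apply: eq_bigr => y _; rewrite gcoef_gsumT mulr1. Qed.

Lemma gcoefM_gsuml D A x :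
  gcoef (gsum D * A) x = \sum_(y in D) gcoef A (y^-1 * x)%g.
Proof.
rewrite gcoefM [RHS]big_mkcond; apply: eq_bigr => y _.
by rewrite gcoef_gsum; case: (y \in D); rewrite ?mul1r ?mul0r.
Qed.

Lemma gcoef_inv_gsum D x : inverse_closed D ->
  gcoef (gsum D) x^-1%g = gcoef (gsum D) x.
Proof. by move/inverse_closedP=> DV; rewrite !gcoef_gsum -mem_invg DV. Qed.

Section Abelian.

Hypothesis abT : abelian [set: gT].

Let mulgC x y : (x * y)%g = (y * x)%g.
Proof. by apply: (centsP abT); rewrite inE. Qed.

Lemma gmulC A B : A * B = B * A.
Proof.
apply/gcoefP => x; rewrite !gcoefM.
rewrite (reindex_inj (inj_comp (mulgI x) invg_inj)); apply: eq_bigr => y _ /=.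
by rewrite mulrC (mulgC x) invMg invgK -mulgA (mulgC y) mulKg.
Qed.

Lemma gcoefM_inv A B : (forall x, gcoef A x^-1%g = gcoef A x) ->
  (forall x, gcoef B x^-1%g = gcoef B x) ->
  forall x, gcoef (A * B) x^-1%g = gcoef (A * B) x.
Proof.
move=> AV BV x; rewrite !gcoefM (reindex_inj invg_inj); apply: eq_bigr => y _ /=.
by rewrite AV -[in RHS]BV !invMg !invgK mulgC.
Qed.

Lemma gcoef1_sqr A : (forall x, gcoef A x^-1%g = gcoef A x) ->
  gcoef (A * A) 1%g = \sum_x gcoef A x ^+ 2.
Proof. by move=> AV; rewrite gcoefM; apply: eq_bigr => x _; rewrite mulg1 AV. Qed.

(** * Power maps with exponent coprime to the group order *)

Section PowerMap.

Variable k : nat.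
Hypothesis co_k : coprime #|gT| k.

Lemma expg_coprime_inj : injective (fun x : gT => x ^+ k)%g.
Proof.
have co : coprime #|[set: gT]%G| k by rewrite cardsT.
by move=> x y xy; rewrite -[x](expgK co) ?inE // -[y](expgK co) ?inE //= xy.
Qed.

Let powI := expg_coprime_inj.

Lemma expg_coprime_surj x : exists y, x = (y ^+ k)%g.
Proof. by have [f fK gK] := injF_bij powI; exists (f x); rewrite gK. Qed.

Lemma gcoef_gring_powX A x : gcoef (gring_pow k A) (x ^+ k)%g = gcoef A x.
Proof. by rewrite gcoef_gring_pow (big_pred1 x) // => y /=; rewrite (inj_eq powI). Qed.

Lemma gring_pow_bound A (m : int) : (forall x, m <= gcoef A x) ->
  forall x, m <= gcoef (gring_pow k A) x.
Proof.
by move=> mA x; have [y ->] := expg_coprime_surj x; rewrite gcoef_gring_powX.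
Qed.

Lemma gcoef_gring_pow1 A : gcoef (gring_pow k A) 1%g = gcoef A 1%g.
Proof. by rewrite -{1}(expg1n gT k) gcoef_gring_powX. Qed.

Lemma gcoef_gring_pow_gsum D x :
  gcoef (gring_pow k (gsum D)) x = (x \in [set y ^+ k | y in D]%g)%:R.
Proof.
have [y ->] := expg_coprime_surj x; rewrite gcoef_gring_powX gcoef_gsum.
by rewrite (mem_imset _ _ powI).
Qed.

Lemma aug_gring_pow A : aug (gring_pow k A) = aug A.
Proof.
by rewrite /aug (reindex_inj powI); apply: eq_bigr => x _; rewrite gcoef_gring_powX.
Qed.

Lemma gring_powD A B : gring_pow k (A + B) = gring_pow k A + gring_pow k B.
Proof.
apply/gcoefP => x; have [y ->] := expg_coprime_surj x.
by rewrite gcoefD !gcoef_gring_powX gcoefD.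
Qed.

Lemma gring_powM A B : gring_pow k (A * B) = gring_pow k A * gring_pow k B.
Proof.
apply/gcoefP => x; have [y ->] := expg_coprime_surj x.
rewrite gcoef_gring_powX !gcoefM [RHS](reindex_inj powI); apply: eq_bigr => z _ /=.
by rewrite -expgVn -expgMn ?gcoef_gring_powX // /commute mulgC.
Qed.

Lemma gring_pow_inv A : (forall x, gcoef A x^-1%g = gcoef A x) ->
  forall x, gcoef (gring_pow k A) x^-1%g = gcoef (gring_pow k A) x.
Proof.
move=> AV x; have [y ->] := expg_coprime_surj x.
by rewrite -expgVn !gcoef_gring_powX AV.
Qed.

End PowerMap.

(** * Frobenius congruences *)

Lemma gelemX x k : gelem x ^+ k = gelem (x ^+ k)%g.
Proof. by elim: k => [|k IHk]; rewrite ?expr0 // exprS IHk -gelemM expgS. Qed.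

Lemma gring_pow_gsum_imset k D :
  gring_pow (Posz k) (gsum D) = \sum_(d in D) gelem (d ^+ k)%g.
Proof.
rewrite /gring_pow [RHS]big_mkcond; apply: eq_bigr => x _.
by rewrite gcoef_gsum; case: (x \in D).
Qed.

(** In a commutative ring [p]-th powers are additive modulo [p], so the power can be taken on each
    group element separately. *)
Lemma gsumX_prime (p : nat) D : prime p ->
  exists C, gsum D ^+ p = gring_pow p (gsum D) + C *+ p.
Proof.
move=> p_pr; rewrite gring_pow_gsum_imset /gsum.
elim: (index_enum gT) => [|x s [C IHs]].
  by exists 0; rewrite !big_nil mul0rn addr0 expr0n (gtn_eqF (prime_gt0 p_pr)).
rewrite !big_cons; case: ifP => _; last by exists C.
have [z ->] := exprD_prime_comm p_pr (gmulC (gelem x) (\sum_(d <- s | d \in D) gelem d)).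
by exists (C + z); rewrite IHs gelemX mulrnDl !addrA.
Qed.

End Abelian.
End GroupRingTheory.

(** * Sizes of the two sets and coefficients of their squares *)

Section Tiling.

Variables (n : nat) (H : finGroupType) (T0 T1 : {set H}).
Implicit Types (x y : H) (D : {set H}).
Hypotheses (n_mod6 : (n = 3 %[mod 6])%N) (abH : abelian [set: H]).
Hypothesis cardH : #|H| = (n ^ 2 + n + 1)%N.
Hypotheses (T0V : inverse_closed T0) (T1V : inverse_closed T1) (T0_1 : 1%g \in T0).
Hypothesis cardT01 : (#|T0| + #|T1| = 2 * n + 1)%N.

Local Notation h := (gsum [set: H]).
Local Notation t0 := (gsum T0).
Local Notation t1 := (gsum T1).
Local Notation p := (gring_pow 2 t0 + gring_pow 2 t1).

Hypothesis t0t1 : t0 * t1 = h - gelem 1%g.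
Hypothesis t0t1_sqr : t0 ^+ 2 + t1 ^+ 2
  = h *+ 2 - gring_pow 2 t0 - gring_pow 2 t1 + gelem 1%g *+ (2 * n).

Let mulC := gmulC abH.

Let co2 : coprime #|H| 2.
Proof. by rewrite coprime_sym prime_coprime // cardH; nia. Qed.

(** Since 3 divides [n], the order [n^2 + n + 1] is 1 modulo 3. *)
Let co3 : coprime #|H| 3.
Proof. by rewrite coprime_sym prime_coprime // cardH; nia. Qed.

Lemma t0t1E x : gcoef (t0 * t1) x = 1 - (x == 1%g)%:R.
Proof. by rewrite t0t1 gcoefD gcoefN gcoef_gsumT gcoef_elem. Qed.

Lemma sqrE x : gcoef (t0 ^+ 2) x + gcoef (t1 ^+ 2) x + gcoef p x
  = 2 + (2 * n)%:R * (x == 1%g)%:R.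
Proof.
rewrite -!gcoefD t0t1_sqr !(gcoefD, gcoefN, gcoefMn) gcoef_gsumT gcoef_elem.
rewrite -[_ *+ (2 * n)]mulr_natl; ring.
Qed.

(** The sizes have sum [2n + 1] and, by augmentation of [t0t1], product [n(n + 1)], so they are [n]
    and [n + 1]. Parity decides which is which: [#|T0|] and [n] are both odd. *)
Lemma card_T0 : #|T0| = n.
Proof.
have [D t0E] := gsumX_prime abH T0 (isT : prime 2).
(* As [T0] is inverse-closed, the coefficient of e in T0^2 is [#|T0|]; modulo 2 it equals that of
   T0^(2), which is 1. *)
have odd0 : exists z : int, #|T0|%:Z = 1 + z * 2.
  exists (gcoef D 1%g); move/gcoefP/(_ 1%g): t0E.
  rewrite gcoefD gcoefMn gcoef_gring_pow1 // gcoef_gsum T0_1.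
  rewrite expr2 gcoef1_sqr //; last first.
    by move=> x; apply: gcoef_inv_gsum.
  rewrite mulr_natr => <-; rewrite -aug_gsum; apply: eq_bigr => x _.
  by rewrite gcoef_gsum; case: (_ \in _).
have augE : #|T0|%:Z * #|T1|%:Z = (n ^ 2 + n)%:Z.
  rewrite -!aug_gsum -augM /aug; under eq_bigr do rewrite t0t1E.
  rewrite big_split /= sumr_const sumrN (bigD1 1%g) //= big1 => [|x /negPf->] //.
  rewrite eqxx cardH; lia.
case: odd0 => z odd0.
have : (#|T0|%:Z - n%:Z) * (#|T0|%:Z - n%:Z - 1) = 0 by nia.
move/eqP; rewrite mulf_eq0 => /orP[]/eqP; lia.
Qed.

Lemma card_T1 : #|T1| = n.+1.
Proof. by have := card_T0; lia. Qed.

Lemma T1_1 : 1%g \notin T1.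
Proof.
apply/negP => e1; have := t0t1E 1%g; rewrite eqxx subrr gcoefM_gsuml.
rewrite (bigD1 1%g) //= invg1 mulg1 gcoef_gsum e1 => /eqP.
by rewrite gt_eqF // ltr_pwDl // sumr_ge0 // => i _; apply: gcoef_gsum_ge0.
Qed.

Lemma p_ge0 x : 0 <= gcoef p x.
Proof.
by rewrite gcoefD addr_ge0 //; apply: gring_pow_bound => // y; apply: gcoef_gsum_ge0.
Qed.

Lemma p_1 : gcoef p 1%g = 1.
Proof. by rewrite gcoefD !gcoef_gring_pow1 // !gcoef_gsum T0_1 (negPf T1_1). Qed.

Lemma p_inv x : gcoef p x^-1%g = gcoef p x.
Proof.
by rewrite !gcoefD !(gring_pow_inv co2) // => y; apply: gcoef_inv_gsum.
Qed.

Lemma aug_p : aug p = (2 * n + 1)%:R.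
Proof. by rewrite augD !aug_gring_pow // !aug_gsum -cardT01 natrD !natz. Qed.

(** Away from e, the coefficients of T0^2, T1^2 and [p] are nonnegative and add up to 2. *)
Lemma sqr_le2 D x : (D == T0) || (D == T1) -> x != 1%g -> gcoef (gsum D ^+ 2) x <= 2.
Proof.
have ge0 E : 0 <= gcoef (gsum E ^+ 2) x.
  by rewrite expr2; apply: gcoefM_ge0 => y; apply: gcoef_gsum_ge0.
move=> DT /negPf x1; have := sqrE x; have := p_ge0 x; have := ge0 T0; have := ge0 T1.
by rewrite x1 mulr0 addr0; case/orP: DT => /eqP->; lia.
Qed.

Lemma sqr_1 D : inverse_closed D -> gcoef (gsum D ^+ 2) 1%g = #|D|%:Z.
Proof.
move=> DV; rewrite expr2 gcoef1_sqr => [|x]; last exact: gcoef_inv_gsum.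
by rewrite -aug_gsum; apply: eq_bigr => x _; rewrite gcoef_gsum; case: (_ \in _).
Qed.

(** * The coefficients of T0 p and their excess over [lam] *)

Local Notation c := (gcoef (t0 * p)).
Local Notation lam x := (2 - 2 * gcoef t1 x - gcoef (gring_pow 3 t0) x).

Lemma c_ge0 x : 0 <= c x.
Proof.
by apply: gcoefM_ge0; [apply: gcoef_gsum_ge0 | apply: p_ge0].
Qed.

Lemma c_inv x : c x^-1%g = c x.
Proof. by apply: gcoefM_inv => // y; [apply: gcoef_inv_gsum | apply: p_inv]. Qed.

Lemma c_mod3 x : exists z : int, c x = lam x + z * 3.
Proof.
have -> : p = h *+ 2 + 1 *+ (2 * n) - t0 ^+ 2 - t1 ^+ 2.
  rewrite -addrA -opprD t0t1_sqr -gelem1 opprD !opprB.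
  by rewrite addrC; apply/gcoefP => y; rewrite !(gcoefD, gcoefN, gcoefMn); lia.
rewrite !(mulrDr, mulrN) !mulrnAr mulr1 -exprS expr2 mulrA t0t1 mulrBl mul1r.
have [D ->] := gsumX_prime abH T0 (isT : prime 3).
rewrite (mulC h) !(gcoefD, gcoefN, gcoefMn, gcoef_mulT, aug_gsum) card_T0 card_T1.
rewrite -[_ *+ (2 * n)]mulr_natl.
have [j nE] : exists j, n%:Z = 3 * j by exists (n %/ 3)%N%:Z; move: n_mod6; lia.
have -> : n.+1%:Z = n%:Z + 1 by lia.
have -> : (2 * n)%:R = 2 * n%:Z by lia.
(* Here T0 p = (n - 1) H + 2n T0 + T1 - T0^3, where T0^3 = T0^(3) + 3D and n = 3j; subtracting [lam]
   leaves three times this witness. *)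
rewrite nE; exists ((j - 1) + 2 * j * gcoef t0 x + gcoef t1 x - gcoef D x); ring.
Qed.

(** Since [c x] is nonnegative and [lam x] is at most 2, their difference is a multiple of 3 that is
    at least -2, hence nonnegative. *)
Lemma lam_le_c x : lam x <= c x.
Proof.
have [z cE] := c_mod3 x; have := c_ge0 x; move: cE.
by rewrite gcoef_gsum gcoef_gring_pow_gsum //; do 2 case: (x \in _); lia.
Qed.

Lemma lam_le2 x : 0 <= 2 - lam x.
Proof. by rewrite gcoef_gsum gcoef_gring_pow_gsum //; do 2 case: (x \in _). Qed.

Lemma sum_2Blam : \sum_x (2 - lam x) = (3 * n + 2)%:R.
Proof.
transitivity (2 * aug t1 + aug (gring_pow 3 t0)).
  by rewrite /aug mulr_sumr -big_split; apply: eq_bigr => x _ /=; ring.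
by rewrite aug_gring_pow // !aug_gsum card_T0 card_T1; lia.
Qed.

Lemma sum_c : \sum_x c x = (n * (2 * n + 1))%:R.
Proof. by rewrite -/(aug _) augM aug_p aug_gsum card_T0; nia. Qed.

Lemma t1_t0pE : t1 * (t0 * p) = p * h - p.
Proof. by rewrite mulrA (mulC t1) t0t1 mulrBl mul1r mulC. Qed.

Lemma sum_c_T1 : \sum_(x in T1) c x = (2 * n)%:R.
Proof.
transitivity (gcoef (t1 * (t0 * p)) 1%g).
  by rewrite gcoefM_gsuml; apply: eq_bigr => x _; rewrite mulg1 c_inv.
by rewrite t1_t0pE gcoefD gcoefN gcoef_mulT aug_p p_1; lia.
Qed.

Lemma c_notinT1 x : x \notin T1 -> c x <= 2.
Proof.
move=> xT1; suff : c x - lam x <= 0 by have := lam_le2 x; lia.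
have ge0 y : 0 <= c y - lam y by rewrite subr_ge0 lam_le_c.
have tot : \sum_y (c y - lam y) = (2 * n)%:R.
  transitivity (\sum_y c y + \sum_y (2 - lam y) - \sum_(y : H) 2).
    by rewrite -sumrN -!big_split; apply: eq_bigr => y _ /=; ring.
  by rewrite sum_c sum_2Blam sumr_const cardH; lia.
(* On [T1] the value of [lam] is at most 0, so the excess there is at least [c], whose sum over [T1]
   is already the total excess. *)
have onT1 : \sum_(y in T1) (c y - lam y) >= (2 * n)%:R.
  rewrite -sum_c_T1; apply: ler_sum => y yT1; rewrite gcoef_gsum yT1.
  by rewrite gcoef_gring_pow_gsum //; case: (y \in _); lia.
move: tot; rewrite (bigID (mem T1)) (bigD1 x xT1) /=.
have : 0 <= \sum_(y | (y \notin T1) && (y != x)) (c y - lam y) by apply: sumr_ge0.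
set r := \sum_(y | _) _; move: onT1; set q := \sum_(y in T1) _; set u := c x - _; lia.
Qed.

(* In the coefficient of [y] in T1^2 (T0 p) = (2n+1)(n+1) H - T1 p, the value
   [c y] has weight [n+1] and all others weight at most 2: a large [c y] cannot be
   compensated, since the total of [2 - lam] is only [3n+2]. *)
Lemma c_le6 y : c y <= 6.
Proof.
set s := gcoef (t1 ^+ 2).
have s_ge0 z : 0 <= s z.
  by rewrite /s expr2; apply: gcoefM_ge0 => u; apply: gcoef_gsum_ge0.
have s1 : s 1%g = n.+1%:Z by rewrite /s sqr_1 // card_T1.
have sum_s : \sum_z s z = (n.+1 * n.+1)%:Z.
  by rewrite -/(aug _) expr2 augM aug_gsum card_T1; lia.
have sum_sc : \sum_z s z * c (z^-1 * y)%g <= (n.+1 * (2 * n + 1))%:Z.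
  rewrite -gcoefM expr2 -mulrA t1_t0pE mulrBr mulrA gcoefD gcoefN gcoef_mulT.
  have : 0 <= gcoef (t1 * p) y.
    by apply: gcoefM_ge0; [apply: gcoef_gsum_ge0 | apply: p_ge0].
  by rewrite augM aug_p aug_gsum card_T1; move: (gcoef (t1 * p) y) => d; nia.
have bound : \sum_(z | z != 1%g) s z * (2 - c (z^-1 * y)%g) <= 2 * (3 * n + 2)%:R.
  apply: (@le_trans _ _ (\sum_(z | z != 1%g) 2 * (2 - lam (z^-1 * y)%g))).
    apply: ler_sum => z z1; have := lam_le_c (z^-1 * y)%g.
    have := lam_le2 (z^-1 * y)%g; have := s_ge0 z.
    have : s z <= 2 by apply: sqr_le2; rewrite ?eqxx ?orbT.
    set l := lam _; set cz := c _; nia.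
  rewrite -sum_2Blam -mulr_sumr ler_pM2l //.
  rewrite [leRHS](reindex_inj (inj_comp (mulIg y) invg_inj)) /=.
  by rewrite [leRHS](bigD1 1%g) //= lerDr lam_le2.
have : \sum_z s z * (2 - c (z^-1 * y)%g)
    = 2 * \sum_z s z - \sum_z s z * c (z^-1 * y)%g.
  by rewrite mulr_sumr -sumrN -[RHS]big_split; apply: eq_bigr => z _ /=; ring.
rewrite (bigD1 1%g) //= invg1 mul1g s1 sum_s.
move: sum_sc bound; set q := \sum_z _; set r := \sum_(z | _) _; set d := c y.
(* The estimates combine to (n + 1)(d - 2) <= 5n + 3 < 5(n + 1), hence d <= 6. *)
clearbody q r d; nia.
Qed.

(** * Upper and lower bounds for the second moment of [c] *)

Lemma sum_sqr_c_le : \sum_x c x ^+ 2 <= (4 * n ^ 2 + 10 * n)%:R.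
Proof.
(* Pointwise, c^2 <= 2c off [T1] and c^2 <= 6c = 2c + 4c on [T1]. *)
apply: (@le_trans _ _ (2 * \sum_x c x + 4 * \sum_(x in T1) c x)); last first.
  by rewrite sum_c sum_c_T1; lia.
rewrite !mulr_sumr [X in _ <= _ + X]big_mkcond -[leRHS]big_split.
apply: ler_sum => x _ /=.
have := c_ge0 x; case: ifPn => [_|/c_notinT1]; first have := c_le6 x; nia.
Qed.

(** As p = (T0 + T1)^(2), the coefficient of p^2 at y^2 is that of (T0 + T1)^2 at y, which the two
    hypotheses on products determine. *)
Lemma sqr_pE y : gcoef (p * p) (y ^+ 2)%g
  = 4 - gcoef p y + ((2 * n)%:R - 2) * (y == 1%g)%:R.
Proof.
rewrite -gring_powD // -gring_powM // gcoef_gring_powX //.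
rewrite mulrDl !mulrDr (mulC t1 t0) -!expr2 !gcoefD !t0t1E gring_powD //.
have := sqrE y; rewrite gcoefD; lia.
Qed.

Lemma sum_sqr_c_ge : (6 * n ^ 2)%:R - (7 * n)%:R <= \sum_x c x ^+ 2.
Proof.
rewrite -(gcoef1_sqr c_inv) -mulrA (mulC p) -!mulrA mulrA -expr2 mulC gcoefM.
(* Squaring permutes [H], so the sum may run over squares, where [sqr_pE] gives the coefficients of
   p^2. *)
rewrite (reindex_inj (expg_coprime_inj co2)) /=.
pose w y := gcoef (t0 ^+ 2) ((y ^+ 2)^-1 * 1)%g.
have w1 : w 1%g = n%:R by rewrite /w expg1n invg1 mulg1 sqr_1 // card_T0 natz.
have w_le2 y : y != 1%g -> w y <= 2.
  move=> y1; apply: sqr_le2; rewrite ?eqxx // mulg1 invg_eq1.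
  by rewrite -(expg1n H 2) (inj_eq (expg_coprime_inj co2)).
have sum_w : \sum_y w y = (n ^ 2)%:R.
  transitivity (\sum_z gcoef (t0 ^+ 2) (z^-1 * 1)%g).
    by rewrite [RHS](reindex_inj (expg_coprime_inj co2)).
  rewrite (reindex_inj invg_inj); under eq_bigr do rewrite invgK mulg1.
  by rewrite -/(aug _) expr2 augM aug_gsum card_T0; lia.
(* The term at e is n; the others have weight at most 2 against the remaining mass 2n of [p]. *)
have sum_pw : \sum_y gcoef p y * w y <= (5 * n)%:R.
  rewrite (bigD1 1%g) //= p_1 w1 mul1r.
  have : \sum_(y | y != 1%g) gcoef p y * w y <= \sum_(y | y != 1%g) gcoef p y * 2.
    by apply: ler_sum => y y1; rewrite ler_wpM2l ?p_ge0 ?w_le2.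
  have := aug_p; rewrite /aug (bigD1 1%g) //= p_1 -mulr_suml.
  set q := \sum_(y | _) _; set r := \sum_(y | _) _; clearbody q r; lia.
rewrite (eq_bigr (fun y => (4 * w y - gcoef p y * w y)
    + ((2 * n)%:R - 2) * ((y == 1%g)%:R * w y))) => [|y _]; last first.
  by rewrite sqr_pE -/(w y); ring.
rewrite [leRHS]big_split sumrB -!mulr_sumr sum_w.
have -> : \sum_y (y == 1%g)%:R * w y = n%:R.
  by rewrite (bigD1 1%g) //= eqxx mul1r w1 big1 ?addr0 // => y /negPf->; rewrite mul0r.
move: sum_pw => /=; set q := \sum_y _; clearbody q; nia.
Qed.

Lemma n_eq3 : n = 3%N.
Proof.
have := le_trans sum_sqr_c_ge sum_sqr_c_le; rewrite -!mulnn => le_n.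
have {le_n} : (n * n * 2 <= n * 17)%N by lia.
have n_gt0 : (0 < n)%N by move: n_mod6; lia.
by rewrite -mulnA leq_pmul2l // => n_le8; move: n_mod6; lia.
Qed.

(** * The case n = 3 in the cyclic group of order 13 *)

Lemma order13_contra : n = 3%N -> False.
Proof.
move=> n3; have c13 : #|H| = 13%N by rewrite cardH n3.
have [a aT0 a1] : exists2 a, a \in T0 & a != 1%g.
  have : (0 < #|T0 :\ 1%g|)%N.
    by have := cardsD1 1%g T0; rewrite T0_1 card_T0 n3 add1n => -[<-].
  by case/card_gt0P=> a; rewrite !inE => /andP[]; exists a.
have ord_a : #[a]%g = 13%N.
  have [_ /(_ #[a]%g)] := primeP (isT : prime 13).
  rewrite -[in X in (_ %| X)%N]c13 -cardsT order_dvdG ?inE //.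
  by move=> /(_ isT)/orP[]/eqP // /eqP; rewrite order_eq1 (negPf a1).
have aX i j : (a ^+ i == a ^+ j)%g = (i == j %[mod 13])%N.
  by rewrite eq_expg_mod_order ord_a.
have aX1 i : (a ^+ i == 1)%g = (13 %| i)%N by rewrite -order_dvdn ord_a.
have a13 : (a ^+ 13 = 1)%g by apply/eqP; rewrite aX1.
have aV : (a^-1 = a ^+ 12)%g by apply: (mulgI a); rewrite mulgV -expgS a13.
have e1a : (1 == a)%g = false by rewrite eq_sym (negPf a1).
have e1b : (1 == a ^+ 12)%g = false by rewrite eq_sym aX1.
have eab : (a == a ^+ 12)%g = false by rewrite -{1}(expg1 a) aX.
have T0E : T0 = [set 1; a; a ^+ 12]%g.
  apply/esym/eqP; rewrite eqEcard card_T0 n3; apply/andP; split.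
    have aVT0 : (a ^+ 12)%g \in T0.
      by move/inverse_closedP: T0V => <-; rewrite -aV mem_invg invgK.
    by apply/subsetP => x; rewrite !inE -orbA => /or3P[]/eqP->.
  by rewrite -setUA cardsU1 cards2 !inE e1a e1b eab.
pose u i := (a ^+ i)%g \in T1.
(* Comparing coefficients of a^i in T0 T1 = H - e; the exponent [i + 12] stands for i - 1, avoiding
   subtraction. *)
have uE i : (u i + u (i + 12) + u (i + 1) + (13 %| i) = 1)%N.
  have := t0t1E (a ^+ i)%g; rewrite gcoefM_gsuml T0E -setUA.
  rewrite big_setU1 ?inE ?e1a ?e1b //= big_setU1 ?inE ?eab //=.
  rewrite big_set1 invg1 mul1g aX1 aV -aV invgK.
  rewrite aV -expgD -expgS !gcoef_gsum /u addnC addn1 addnC.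
  by do 3 case: (_ \in _); case: (dvdn 13 i).
have uS i : (u i + u i.+1 + u i.+2 + (13 %| i.+1) = 1)%N.
  have uP : u (i.+1 + 12)%N = u i.
    by rewrite /u (_ : i.+1 + 12 = i + 13)%N ?expgD ?a13 ?mulg1 //; lia.
  by have := uE i.+1; rewrite uP addn1 [(u i.+1 + _)%N]addnC.
have [u0 u1] : u 0 = false /\ u 1 = false.
  by have := uE 0%N; rewrite dvdn0 /= add0n; do 3 case: (u _).
have step i : ~~ (13 %| i.+1)%N -> u i.+2 = ~~ u i && ~~ u i.+1.
  by have := uS i; case: (dvdn 13 _) => //; do 3 case: (u _).
(* From [u 0] and [u 1] false, the recursion makes [u] true at 2, 5, 8, 11. *)
have u_mem k : k \in [:: 5; 8; 11]%N -> (a ^+ k)%g \in T1.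
  have u2 := step 0%N isT; rewrite u0 u1 /= in u2.
  have u3 := step 1%N isT; rewrite u1 u2 /= in u3.
  have u4 := step 2%N isT; rewrite u2 u3 /= in u4.
  have u5 := step 3%N isT; rewrite u3 u4 /= in u5.
  have u6 := step 4%N isT; rewrite u4 u5 /= in u6.
  have u7 := step 5%N isT; rewrite u5 u6 /= in u7.
  have u8 := step 6%N isT; rewrite u6 u7 /= in u8.
  have u9 := step 7%N isT; rewrite u7 u8 /= in u9.
  have u10 := step 8%N isT; rewrite u8 u9 /= in u10.
  have u11 := step 9%N isT; rewrite u9 u10 /= in u11.
  by rewrite !inE => /or3P[]/eqP->; [exact: u5 | exact: u8 | exact: u11].
(* Because 16 is 3 modulo 13, the pairs (5, 11), (8, 8), (11, 5) each represent a^3. *)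
have shift k l : (k + l = 16)%N -> ((a ^+ k)^-1 * a ^+ 3 = a ^+ l)%g.
  move=> kl; apply: (mulgI (a ^+ k)%g); rewrite mulKVg -expgD kl.
  by apply/eqP; rewrite aX.
have : gcoef (t1 ^+ 2) (a ^+ 3)%g <= 2 by apply: sqr_le2; rewrite ?eqxx ?orbT ?aX1.
rewrite expr2 gcoefM_gsuml (bigD1 (a ^+ 5)%g) ?u_mem //=.
rewrite (bigD1 (a ^+ 8)%g) ?u_mem ?aX //= (bigD1 (a ^+ 11)%g) ?u_mem ?aX //=.
rewrite (shift 5 11) // (shift 8 8) // (shift 11 5) // !gcoef_gsum !u_mem //.
set r := \sum_(y | _) _; have : 0 <= r by apply: sumr_ge0 => y _; apply: gcoef_gsum_ge0.
by clearbody r; lia.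
Qed.


End Tiling.

Theorem theorem3p6 (n : nat) (H : finGroupType)
    (n_gt0 : (0 < n)%N) (n_mod6 : (n = 3 %[mod 6])%N)
    (abH : abelian [set: H]) (cardH : #|H| = (n ^ 2 + n + 1)%N) :
  ~ exists T0 T1 : {set H},
      [/\ inverse_closed T0, inverse_closed T1, 1%g \in T0
        & (#|T0| + #|T1| = 2 * n + 1)%N] /\
      [/\ gsum T0 * gsum T1 = gsum [set: H] - gelem 1%g
        & gsum T0 ^+ 2 + gsum T1 ^+ 2
            = gsum [set: H] *+ 2 - gring_pow 2 (gsum T0) - gring_pow 2 (gsum T1)
              + gelem 1%g *+ (2 * n)].
Proof.
move=> [T0 [T1 [[T0V T1V T0_1 cardT01] [t0t1 t0t1_sqr]]]].
have n3 := n_eq3 n_mod6 abH cardH T0V T1V T0_1 cardT01 t0t1 t0t1_sqr.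
exact: order13_contra n_mod6 abH cardH T0V T0_1 cardT01 t0t1 t0t1_sqr n3.
Qed.
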